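(* Let $q$ be a prime power and let $r,t,k$ be positive integers with $k\le r$. Let $\mathcal{P}_\Sigma$ be the set of points of a subgeometry $\Sigma\cong \mathrm{PG}(k-1,q)$ of order $q$ of $\mathrm{PG}(r-1,q^t)$. Then $\mathcal{F}_{r,t,q}(\mathcal{P}_\Sigma)=\{\mathcal{F}_{r,t,q}(P) : P\in\mathcal{P}_\Sigma\}$, a set of $(t-1)$-dimensional subspaces of $\mathrm{PG}(rt-1,q)$, is projectively equivalent to the system of $(t-1)$-spaces of a Segre variety $\mathcal{S}_{k-1,t-1}$ contained in the Segre variety $\mathcal{S}_{r-1,t-1}$ of $\mathrm{PG}(rt-1,q)$.
   Context: Notation: $\mathrm{PG}(n-1,q)=\mathrm{PG}(\mathbb{F}_q^n)$ is the projective space of $\mathbb{F}_q^n$; its points are written $\mathbb{F}_q v$ with $v\neq 0$; dimensions of subspaces are projective. Field reduction map: regard $\mathbb{F}_{q^t}^r$ as an $rt$-dimensional vector space $V$ over $\mathbb{F}_q$, so that $\mathrm{PG}(V)\cong\mathrm{PG}(rt-1,q)$. For a subspace $\pi=\mathrm{PG}(U)$ of $\mathrm{PG}(r-1,q^t)$, where $U$ is a $k$-dimensional $\mathbb{F}_{q^t}$-subspace of $\mathbb{F}_{q^t}^r$, $\mathcal{F}_{r,t,q}(\pi)$ is the $(kt-1)$-dimensional subspace of $\mathrm{PG}(rt-1,q)$ defined by $U$ viewed as an $\mathbb{F}_q$-subspace of $V$. Subgeometry: a subgeometry $\Sigma\cong\mathrm{PG}(k-1,q)$ of order $q$ of $\mathrm{PG}(r-1,q^t)$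 is the set of points of a $(k-1)$-dimensional subspace of $\mathrm{PG}(r-1,q^t)$ whose coordinates with respect to some fixed frame of that subspace can be taken in $\mathbb{F}_q$; i.e. there are $\mathbb{F}_{q^t}$-linearly independent vectors $w_1,\dots,w_k$ such that its points are the $\mathbb{F}_{q^t}(a_1w_1+\dots+a_kw_k)$ with $(a_1,\dots,a_k)\in\mathbb{F}_q^k\setminus\{0\}$. Segre variety: the Segre map $\sigma_{l,m}:\mathrm{PG}(l,q)\times\mathrm{PG}(m,q)\to\mathrm{PG}((l+1)(m+1)-1,q)$ sends $(\mathbb{F}_q(x_0,\dots,x_l),\mathbb{F}_q(y_0,\dots,y_m))$ to $\mathbb{F}_q(x_0y_0,\dots,x_0y_m,\dots,x_ly_0,\dots,x_ly_m)$; its image (up to projectivity, possibly inside a subspace of a larger projective space) is the Segre variety $\mathcal{S}_{l,m}$. Fixing a point of $\mathrm{PG}(l,q)$ and varying the point of $\mathrm{PG}(m,q)$ gives an $m$-dimensional subspace on $\mathcal{S}_{l,m}$; the set of all these is the system of $m$-spaces of $\mathcal{S}_{l,m}$. Similarly, fixing points of $\mathrm{PG}(m,q)$ gives the system of $l$-spaces. In particular the system of $(t-1)$-spaces of $\mathcal{S}_{k-1,t-1}$ is indexed by the points of $\mathrm{PG}(k-1,q)$. Two sets of subspaces of $\mathrm{PG}(rt-1,q)$ are projectively equivalent if some element of $\mathrm{PGL}(rt,q)$ maps one onto the other. *)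

(* Defs.v *)
From HB Require Import structures.
From mathcomp Require Import all_boot all_order all_algebra all_field.
From mathcomp Require Import classical_sets.

Set Implicit Arguments.
Unset Strict Implicit.
Unset Printing Implicit Defensive.

Import GRing.Theory VectorInternalTheory.
Local Open Scope classical_set_scope.
Local Open Scope ring_scope.

(* A subspace of PG(V) is a U : {vspace V}; its projective dimension is
   \dim U - 1, and its points are the lines <[v]> with v != 0 in U. *)

Section RestrictScalars.

Variables (F : fieldType) (L : fieldExtType F).

Section Structure.

Variable V : vectType L.

(* V with the scalars restricted from L to F. *)
Definition restrict_scalars : Type := V.

HB.instance Definition _ := GRing.Zmodule.on restrict_scalars.

Definition rs_scale (a : F) (v : restrict_scalars) : restrict_scalars :=
  (a%:A : L) *: (v : V).

Fact rs_scaleA a b v : rs_scale a (rs_scale b v) = rs_scale (a * b) v.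
Proof. by rewrite /rs_scale scalerA -in_algE -rmorphM. Qed.

Fact rs_scale1 : left_id 1 rs_scale.
Proof. by move=> v; rewrite /rs_scale scale1r; apply: (@scale1r L V). Qed.

Fact rs_scaleDr : right_distributive rs_scale +%R.
Proof. by move=> a u v; apply: (@scalerDr L V). Qed.

Fact rs_scaleDl v : {morph rs_scale^~ v : a b / a + b}.
Proof.
by move=> a b; rewrite /rs_scale scalerDl; apply: (@scalerDl L V).
Qed.

HB.instance Definition _ := GRing.Zmodule_isLmodule.Build F restrict_scalars
  rs_scaleA rs_scale1 rs_scaleDr rs_scaleDl.

Lemma rs_scaleE (a : F) (v : restrict_scalars) :
  a *: v = (a%:A : L) *: (v : V).
Proof. by []. Qed.

Fact rs_vect_iso : Vector.axiom (dim V * dim L) restrict_scalars.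
Proof.
pose h (v : restrict_scalars) :=
  mxvec (\matrix_(i < dim V) v2r (v2r (v : V) 0 i : L)).
pose h' (u : 'rV[F]_(dim V * dim L)) : restrict_scalars :=
  (r2v (\row_i r2v (row i (vec_mx u))) : V).
exists h.
  move=> a u v; rewrite /h -linearP; congr mxvec.
  apply/matrixP=> i j; rewrite !mxE.
  have -> : v2r (a *: u + v : V) = (a%:A : L) *: v2r (u : V) + v2r (v : V).
    by rewrite -linearP.
  by rewrite !mxE mulr_algl linearP !mxE.
exists h' => [v|u].
  rewrite /h' /h mxvecK -[RHS](@v2rK _ V); congr r2v.
  by apply/rowP=> i; rewrite mxE rowK v2rK.
rewrite /h' /h; apply: (canLR vec_mxK); apply/matrixP=> i j.
by rewrite mxE r2vK mxE r2vK mxE.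
Qed.

HB.instance Definition _ :=
  Lmodule_hasFinDim.Build F restrict_scalars rs_vect_iso.

Lemma dim_restrict_scalars :
  \dim {:restrict_scalars} = (\dim {:V} * \dim {:L})%N.
Proof. by rewrite !dimvf. Qed.

(* U regarded as an F-subspace; see mem_vrestrict. *)
Definition vrestrict (U : {vspace V}) : {vspace restrict_scalars} :=
  <<[seq (c *: u : V) : restrict_scalars
      | c <- vbasis {:L}, u <- vbasis U]>>%VS.

Lemma mem_vrestrict U : vrestrict U =i U.
Proof.
move=> v; apply/idP/idP.
  move=> /(@coord_span _ _ _ (in_tuple _)) ->.
  elim/big_ind: _ => [|x y|i _]; [exact: (mem0v U) | exact: (@memvD _ _ U) |].
  apply: (@memvZ _ _ U).
  set s := in_tuple _.
  have /allpairsP[[c u] /= [_ Uu ->]] : s`_i \in s by apply: mem_nth.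
  by apply: memvZ; apply: vbasis_mem.
move=> Uv; rewrite (coord_vbasis Uv).
have memS (I : Type) (r : seq I) (G : I -> V) :
    (forall i, (G i : restrict_scalars) \in vrestrict U) ->
  ((\sum_(i <- r) G i : V) : restrict_scalars) \in vrestrict U.
  move=> GU; elim: r => [|i r IHr]; first by rewrite big_nil; apply: mem0v.
  by rewrite big_cons; apply: (@memvD _ _ (vrestrict U)).
apply: (memS) => i; set x := coord _ _ _.
rewrite (coord_vbasis (memvf x)) scaler_suml; apply: (memS) => j.
rewrite -[X in X *: _](mulr_algl) -scalerA.
apply: (@memvZ _ _ (vrestrict U)); apply: memv_span.
by apply: allpairs_f; apply: mem_nth; rewrite size_tuple.
Qed.

End Structure.

(* The field reduction map into PG(n-1, q), the identification of PG(V) with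
   PG(n-1, q) being given by phi. *)
Definition field_reduction (V : vectType L) (n : nat)
    (phi : 'Hom(restrict_scalars V, 'rV[F]_n)) (U : {vspace V}) :
    {vspace 'rV[F]_n} :=
  (phi @: vrestrict U)%VS.

(* S is the set of points of a subgeometry PG(k-1, F) of PG(V). *)
Definition is_subgeometry (V : vectType L) (k : nat) (S : set {vspace V}) :
    Prop :=
  exists w : k.-tuple V, free w /\
    S = [set P | exists a : 'rV[F]_k,
           a != 0 /\ P = <[\sum_(i < k) (a 0 i)%:A *: tnth w i]>%VS].

End RestrictScalars.

Section Segre.

Variable F : fieldType.

(* On coordinate vectors; mxvec is row-major, so this is
   (x_0 y_0, x_0 y_1, ..., x_1 y_0, ...). *)
Definition segre_map (a b : nat) (x : 'rV[F]_a) (y : 'rV[F]_b) :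
    'rV[F]_(a * b) :=
  mxvec (x^T *m y).

Fact segre_map_is_linear a b (x : 'rV[F]_a) : linear (@segre_map a b x).
Proof. by move=> c u v; rewrite /segre_map !linearP. Qed.

HB.instance Definition _ a b (x : 'rV[F]_a) :=
  GRing.isLinear.Build F 'rV[F]_b 'rV[F]_(a * b) _ (segre_map x)
    (segre_map_is_linear x).

(* a and b are vector space dimensions: for f injective, these are the points,
   and the system of (b-1)-spaces, of a Segre variety S_{a-1,b-1} in PG(W). *)
Definition segre_variety (a b : nat) (W : vectType F)
    (f : 'Hom('rV[F]_(a * b), W)) : set {vspace W} :=
  [set P | exists (x : 'rV[F]_a) (y : 'rV[F]_b),
     [/\ x != 0, y != 0 & P = <[f (segre_map x y)]>%VS]].

Definition segre_system (a b : nat) (W : vectType F)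
    (f : 'Hom('rV[F]_(a * b), W)) : set {vspace W} :=
  [set X | exists x : 'rV[F]_a,
     x != 0 /\ X = (f @: limg (linfun (@segre_map a b x)))%VS].

Definition projectively_equivalent (W : vectType F) (A B : set {vspace W}) :
    Prop :=
  exists g : 'End(W), lker g == 0%VS /\ [set (g @: X)%VS | X in A] = B.

End Segre.

(* Main.v *)
Require Import Defs.
From HB Require Import structures.
From mathcomp Require Import all_boot all_order all_algebra all_field.
From mathcomp Require Import classical_sets.

(** Let [w_1, ..., w_k] be the vectors that define the subgeometry, so that its
    points are the lines [L w_a] with [w_a = \sum_i a_i w_i] and [a] over [F].
    Identify [L] with [F^t].  A [k * t] matrix over [F] is then a column of [k]
    scalars [c_i] of [L], and sending it to [\sum_i c_i w_i] is an injective
    [F]-linear map, because the [w_i] are free over [L] ([expand_rows],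
    [expand_rows_inj]).  The rank one matrix [a^T y] goes to [y w_a]: the
    Segre space over the point [a] is carried exactly onto the reduction of the
    point [L w_a] ([limg_expand_rows_segre]), so the reduced subgeometry is the
    system of [(t-1)-]spaces of the Segre variety embedded by [expand_rows].

    Padding with [r - k] zero rows embeds [k * t] matrices in [r * t] matrices
    and takes [x^T y] to [(x, 0)^T y], hence puts a Segre variety
    [S_(k-1,t-1)] inside [S_(r-1,t-1)] ([segre_variety_pad_rows]).  Two
    injective linear maps into the same space differ by an automorphism of that
    space ([inj_hom_conjugate]).  The one that turns [phi \o expand_rows] into
    the padding map is the required projectivity. *)

Set Implicit Arguments.
Unset Strict Implicit.
Unset Printing Implicit Defensive.

Import GRing.Theory VectorInternalTheory.
Local Open Scope classical_set_scope.
Local Open Scope ring_scope.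

Lemma lker0_dim_img (F : fieldType) (U W : vectType F) (f : 'Hom(U, W))
    (X : {vspace U}) :
  lker f == 0%VS -> \dim (f @: X)%VS = \dim X.
Proof. by move=> /eqP kf; apply: limg_dim_eq; rewrite kf capv0. Qed.

Lemma lker0_comp (F : fieldType) (U V W : vectType F) (f : 'Hom(V, W))
    (g : 'Hom(U, V)) :
  lker f == 0%VS -> lker g == 0%VS -> lker (f \o g)%VF == 0%VS.
Proof.
move=> /lker0P fI /lker0P gI; apply/lker0P => x y.
by rewrite !comp_lfunE => /fI/gI.
Qed.

Lemma lker0_linfun (F : fieldType) (U W : vectType F) (f : {linear U -> W}) :
  injective f -> lker (linfun f) == 0%VS.
Proof. by move=> fI; apply/lker0P => x y; rewrite !lfunE => /fI. Qed.

(** In matrix form, [A G = B] is solved by [G = A^+ B] since [A] has independent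
    rows; as [A] and [B] have the same rank, this [G] is injective on the row
    space of [A], so it can be changed off that row space into a unit. *)
Lemma inj_hom_conjugate (F : fieldType) (m n : nat)
    (f1 f2 : 'Hom('rV[F]_m, 'rV[F]_n)) :
  lker f1 == 0%VS -> lker f2 == 0%VS ->
  exists g : 'End('rV[F]_n), lker g == 0%VS /\ (g \o f1 = f2)%VF.
Proof.
move=> k1 k2.
have free_mx (f : 'Hom('rV[F]_m, 'rV[F]_n)) :
    lker f == 0%VS -> row_free (lin1_mx f).
  move=> /lker0P fI; apply: inj_row_free => v; rewrite mul_rV_lin1 => fv0.
  by apply: fI; rewrite fv0 linear0.
have [A1 A2] := (free_mx _ k1, free_mx _ k2).
have solve : lin1_mx f1 *m (pinvmx (lin1_mx f1) *m lin1_mx f2) = lin1_mx f2.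
  by rewrite mulmxA mulmxVp // mul1mx.
have [|G Gunit defG] :=
  @complete_unitmx _ _ _ (lin1_mx f1) (pinvmx (lin1_mx f1) *m lin1_mx f2).
  by rewrite solve; move: A1 A2 => /eqP-> /eqP->.
exists (linfun (mulmxr G)); split.
  by apply: lker0_linfun; apply: can_inj (mulmxK Gunit).
apply/lfunP => v; rewrite comp_lfunE lfunE /=.
by rewrite -[f1 v]mul_rV_lin1 -mulmxA -defG solve mul_rV_lin1.
Qed.

Lemma segre_map_inj (F : fieldType) (a b : nat) (x : 'rV[F]_a) :
  x != 0 -> injective (@segre_map F a b x).
Proof.
move=> x0; apply: raddf_inj => y /(canRL mxvecK); rewrite linear0 => xy0.
have /rV0Pn[i xi0] := x0; apply/rowP => j.
move: xy0 => /matrixP/(_ i j); rewrite !mxE big_ord1 !mxE => /eqP.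
by rewrite mulf_eq0 (negPf xi0) => /eqP.
Qed.

Section PadRows.

Variables (F : fieldType) (k r t : nat).
Hypothesis le_kr : (k <= r)%N.

Definition pad_rows (u : 'rV[F]_(k * t)) : 'rV[F]_(r * t) :=
  mxvec ((pid_mx k : 'M[F]_(r, k)) *m vec_mx u).

Fact pad_rows_is_linear : linear pad_rows.
Proof. by move=> c u v; rewrite /pad_rows !linearP. Qed.

HB.instance Definition _ := GRing.isLinear.Build F 'rV[F]_(k * t)
  'rV[F]_(r * t) _ pad_rows pad_rows_is_linear.

Lemma pid_mxK : (pid_mx k : 'M[F]_(k, r)) *m (pid_mx k : 'M[F]_(r, k)) = 1%:M.
Proof. by rewrite mul_pid_mx minnn (minn_idPr le_kr) pid_mx_1. Qed.

Lemma pad_rows_inj : injective pad_rows.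
Proof.
move=> u v /(can_inj mxvecK)/(congr1 (mulmx (pid_mx k : 'M[F]_(k, r)))).
by rewrite !mulmxA pid_mxK !mul1mx => /(can_inj vec_mxK).
Qed.

Lemma pad_rows_segre (x : 'rV[F]_k) (y : 'rV[F]_t) :
  pad_rows (segre_map x y) = segre_map (x *m pid_mx k) y.
Proof.
by rewrite /pad_rows /segre_map mxvecK trmx_mul tr_pid_mx mulmxA.
Qed.

Lemma segre_variety_pad_rows :
  segre_variety (linfun pad_rows) `<=`
    @segre_variety F r t 'rV[F]_(r * t) \1%VF.
Proof.
move=> _ [x [y [x0 y0 ->]]]; exists (x *m pid_mx k), y; split=> //.
  apply: contraNneq x0 => /(congr1 (mulmxr (pid_mx k : 'M[F]_(r, k)))) /=.
  by rewrite -mulmxA pid_mxK mulmx1 mul0mx => ->.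
by rewrite lfunE id_lfunE /= pad_rows_segre.
Qed.

End PadRows.

Section ExpandRows.

Variables (F : fieldType) (L : fieldExtType F) (V : vectType L) (k : nat).
Variable w : k.-tuple V.

(** This is the map of [F^k (x) L] onto the [F]-space [\sum_i L w_i] that
    sends [a (x) c] to [c w_a]; [r2v] identifies [F^(dim L)] with [L]. *)
Definition expand_rows (u : 'rV[F]_(k * dim L)) : restrict_scalars V :=
  \sum_(i < k) (r2v (row i (vec_mx u)) : L) *: tnth w i.

Fact expand_rows_is_linear : linear expand_rows.
Proof.
move=> c u v; rewrite rs_scaleE /expand_rows.
rewrite (@scaler_sumr L V) -(@big_split V).
apply: eq_bigr => i _; rewrite !linearP /= scalerDl scalerA.
by rewrite mulr_algl.
Qed.

HB.instance Definition _ := GRing.isLinear.Build F 'rV[F]_(k * dim L)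
  (restrict_scalars V) _ expand_rows expand_rows_is_linear.

Lemma expand_rows_inj : free w -> injective expand_rows.
Proof.
move=> wfree; apply: raddf_inj => u u0.
apply: (can_inj vec_mxK); rewrite linear0; apply/row_matrixP => i.
apply: (can_inj (@r2vK _ L)); rewrite row0 linear0.
have /freeP/(_ (fun i => r2v (row i (vec_mx u)))) := wfree.
apply; rewrite -[RHS]u0 /expand_rows.
by apply: eq_bigr => j _; rewrite (tnth_nth 0).
Qed.

Lemma expand_rows_segre (a : 'rV[F]_k) (y : 'rV[F]_(dim L)) :
  expand_rows (segre_map a y) =
    (r2v y : L) *: (\sum_(i < k) (a 0 i)%:A *: tnth w i : V).
Proof.
rewrite /expand_rows /segre_map mxvecK scaler_sumr; apply: eq_bigr => i _.
have -> : row i (a^T *m y) = a 0 i *: y.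
  by apply/rowP => j; rewrite !mxE big_ord1 !mxE.
by rewrite linearZ /= scalerA mulr_algr.
Qed.

(** The scalars [r2v y] exhaust [L], so the values [r2v y *: w_a] exhaust the
    whole [L]-line of [w_a]. *)
Lemma limg_expand_rows_segre (a : 'rV[F]_k) :
  (linfun expand_rows @: limg (linfun (segre_map a)))%VS =
  vrestrict <[\sum_(i < k) (a 0 i)%:A *: tnth w i]>%VS.
Proof.
apply/vspaceP => v; rewrite mem_vrestrict; apply/idP/idP.
  move=> /memv_imgP[_ /memv_imgP[y _ ->] ->].
  by rewrite !lfunE /= expand_rows_segre; apply/vlineP; exists (r2v y).
move=> /vlineP[c ->].
rewrite -[c]v2rK -expand_rows_segre -[expand_rows _]lfunE /=.
by apply: memv_img; rewrite -[segre_map a _]lfunE; apply: memv_img; apply: memvf.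
Qed.

End ExpandRows.

Theorem theorem2p4 (F : finFieldType) (L : fieldExtType F) (r t k : nat)
    (r_gt0 : (0 < r)%N) (t_gt0 : (0 < t)%N) (k_gt0 : (0 < k)%N)
    (le_kr : (k <= r)%N) (dimL : \dim {:L} = t)
    (phi : 'Hom(restrict_scalars 'rV[L]_r, 'rV[F]_(r * t)))
    (phi_inj : lker phi == 0%VS)
    (Sigma : set {vspace 'rV[L]_r}) (HSigma : is_subgeometry k Sigma) :
  (forall X, (field_reduction phi @` Sigma) X -> \dim X = t) /\
  exists f : 'Hom('rV[F]_(k * t), 'rV[F]_(r * t)),
    [/\ lker f == 0%VS,
        segre_variety f `<=` @segre_variety F r t 'rV[F]_(r * t) \1%VF
      & projectively_equivalent (field_reduction phi @` Sigma)
          (segre_system f)].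
Proof.
rewrite dimvf in dimL; subst t; case: HSigma => w [wfree ->].
pose psi : 'Hom('rV[F]_(k * dim L), restrict_scalars 'rV[L]_r) :=
  linfun (expand_rows w).
have kpsi : lker psi == 0%VS by apply/lker0_linfun/expand_rows_inj.
split.
  move=> _ [_ [a [a0 ->]] <-].
  rewrite /field_reduction -limg_expand_rows_segre !lker0_dim_img //.
    by rewrite dimvf /dim /= mul1n.
  exact/lker0_linfun/segre_map_inj.
have kpad : lker (linfun (@pad_rows F k r (dim L))) == 0%VS.
  exact/lker0_linfun/pad_rows_inj.
have [g [kg defg]] := inj_hom_conjugate (lker0_comp phi_inj kpsi) kpad.
exists (linfun (@pad_rows F k r (dim L))); split=> //.
  exact: segre_variety_pad_rows.
have image (a : 'rV[F]_k) : (g @: field_reduction phi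
      <[\sum_(i < k) (a 0 i)%:A *: tnth w i]>)%VS =
    (linfun (@pad_rows F k r (dim L)) @: limg (linfun (segre_map a)))%VS.
  by rewrite /field_reduction -limg_expand_rows_segre -defg !limg_comp.
exists g; split=> //; apply/seteqP; split=> X.
  by move=> [_ [_ [a [a0 ->]] <-] <-]; exists a; rewrite image.
move=> [a [a0 ->]]; rewrite -image.
by apply/imageP/imageP; exists a.
Qed.
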